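(* Let $r \ge 1$ and $n$ be integers with $2r < n$, and let $L(C_n^r)$ be the Laplacian matrix of the $r$-nearest neighbor cycle $C_n^r$. Then the eigenvalues of $L(C_n^r)$, listed with multiplicity, are $$\lambda_j(L(C_n^r)) = 2r+1 - \frac{\sin\frac{(2r+1)\pi j}{n}}{\sin\frac{\pi j}{n}}, \qquad j = 0,1,\dots,n-1,$$ where for $j=0$ the quotient is read as its limiting value $2r+1$.
   Context: The $r$-nearest neighbor cycle $C_n^r$ (with $2r<n$) is the simple undirected graph on the vertex set $\mathbb{Z}/n\mathbb{Z}$ in which two distinct vertices are adjacent iff they differ by one of $\pm 1, \dots, \pm r$ modulo $n$ (so every vertex has degree $2r$ and the adjacency matrix is circulant). The Laplacian matrix of a graph is $L = D - A$, where $A$ is the adjacency matrix and $D$ the diagonal matrix of vertex degrees. *)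

(* Defs.v *)
From mathcomp Require Import all_boot all_order all_algebra.
From mathcomp Require Import reals trigo.
Set Implicit Arguments.
Unset Strict Implicit.
Unset Printing Implicit Defensive.
Import Order.TTheory GRing.Theory Num.Theory.
Local Open Scope ring_scope.

(* A simple graph is a symmetric irreflexive relation e on its finite vertex
   type; matrices are indexed by vertices, so the vertex type here is 'I_n. *)
Definition degree (n : nat) (e : rel 'I_n) (i : 'I_n) : nat :=
  #|[set j | e i j]|.

Definition adjacency_mx (R : nzRingType) (n : nat) (e : rel 'I_n) : 'M[R]_n :=
  \matrix_(i, j) (e i j)%:R.

Definition degree_mx (R : nzRingType) (n : nat) (e : rel 'I_n) : 'M[R]_n :=
  diag_mx (\row_i (degree e i)%:R).

Definition laplacian_mx (R : nzRingType) (n : nat) (e : rel 'I_n) : 'M[R]_n :=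
  degree_mx R e - adjacency_mx R e.

(* 'I_n stands for the residues mod n; k : 'I_r encodes the offset k.+1, which
   ranges over 1, ..., r. The notation 'Z_n is avoided because its carrier is
   not 'I_n for a variable n. *)
Definition nn_cycle (r n : nat) : rel 'I_n := fun i j =>
  (i != j) && [exists k : 'I_r,
     (j == i + k.+1 %[mod n])%N || (i == j + k.+1 %[mod n])%N].

Lemma nn_cycle_irrefl (r n : nat) : irreflexive (@nn_cycle r n).
Proof. by move=> i; rewrite /nn_cycle eqxx. Qed.

Lemma nn_cycle_sym (r n : nat) : symmetric (@nn_cycle r n).
Proof.
move=> i j; rewrite /nn_cycle eq_sym; congr (_ && _).
by apply: eq_existsb => k; rewrite orbC.
Qed.

(* The sequence s lists the eigenvalues of A with algebraic multiplicity, and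
   in particular A has no eigenvalue outside R; the order of s is irrelevant. *)
Definition eigenvalues_listed_by (R : comNzRingType) (n : nat) (A : 'M[R]_n)
    (s : seq R) : Prop :=
  char_poly A = \prod_(x <- s) ('X - x%:P).

(* At j = 0 the library quotient would be 0 / 0 = 0, so the limiting value is
   given explicitly. *)
Definition sin_quotient (R : realType) (r n j : nat) : R :=
  if j == 0%N then (2 * r + 1)%:R
  else sin ((2 * r + 1)%:R * pi * j%:R / n%:R) / sin (pi * j%:R / n%:R).

(* Main.v *)
Require Import Defs.
From mathcomp Require Import all_boot all_order all_algebra.
From mathcomp Require Import reals trigo.
From mathcomp Require Import zify ring.
Import Order.TTheory GRing.Theory Num.Theory.
Local Open Scope ring_scope.

(** The graph is circulant and symmetric, so its Laplacian is diagonalized over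
    the reals by the discrete Hartley transform, whose entries are
    cas (2 pi i j / n) with cas x = cos x + sin x; this avoids the complex
    Fourier matrix. Two identities make it work.

    First, cas (x + y) + cas (x - y) = 2 cos y cas x. Around a vertex i the
    neighbours are i + k and i - k for k = 1, ..., r, so summing over them
    multiplies the j-th Hartley column by 2 cos (2 pi j k / n) summed over k
    ([sum_nn_cycle], [sum_nn_cycle_cas]); that multiplier plus 1 is the
    Dirichlet kernel, i.e. the quotient of sines ([sin_quotientE]). Since every
    degree is 2r, the Laplacian L, the Hartley matrix H and the diagonal matrix
    D of the claimed values satisfy L H = H D.

    Second, cas x cas y = cos (x - y) + sin (x + y). The sum of a sinusoid over
    equally spaced angles that make full turns vanishes, whence H H = n I
    ([hartley_mxM]). So H is invertible, L and D are similar, and the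
    characteristic polynomial of L is that of D. Comparing characteristic
    polynomials settles multiplicities without any discussion of coinciding
    eigenvalues.

    Both the Dirichlet kernel and the vanishing sums come from one telescoping
    formula, [sum_cos_progression]. *)

(** * Similar matrices *)

Lemma char_poly_similar {K : idomainType} {n : nat} {A B P : 'M[K]_n} :
  \det P != 0 -> A *m P = P *m B -> char_poly A = char_poly B.
Proof.
move=> P0 AP.
have detP0 : \det (map_mx polyC P) != 0 by rewrite det_map_mx polyC_eq0.
apply: (mulIf detP0).
rewrite [RHS]mulrC /char_poly -!det_mulmx /char_poly_mx mulmxBl mulmxBr.
by rewrite mul_mx_scalar mul_scalar_mx -!map_mxM AP.
Qed.

(** * Neighbours in the cycle *)

(** Offsets are taken in the cyclic group 'I_n.+1; a backward step by k is the
    forward offset n.+1 - k, which lies in the top range of r residues. *)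
Lemma nn_cycle_shift {r n : nat} (i d : 'I_n.+1) : (2 * r < n.+1)%N ->
  @nn_cycle r n.+1 i (i + d) = (0 < d < r.+1)%N || (n.+1 - r <= d)%N.
Proof.
move=> hn; have := ltn_ord d => dn.
have neq : (i != i + d) = (0 < d)%N by rewrite -[X in X != _]addr0 (inj_eq (addrI i)) eq_sym -lt0n.
rewrite /nn_cycle neq.
have -> : [exists k : 'I_r, ((i + d)%R == i + k.+1 %[mod n.+1])%N
      || (i == (i + d)%R + k.+1 %[mod n.+1])%N]
 = [exists k : 'I_r, (d == k.+1 :> nat) || (d + k.+1 == n.+1)%N].
  apply: eq_existsb => k; have := ltn_ord k => kr.
  rewrite /= modn_mod modnDml eqn_modDl (modn_small dn) (@modn_small k.+1); last by lia.
  congr (_ || _).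
  rewrite -addnA -[X in (X == _ %[mod _])]addn0 eqn_modDl mod0n eq_sym.
  apply/eqP/eqP => [/eqP|->]; last by rewrite modnn.
  by move=> /dvdnP[[|[|q]]]; lia.
apply/andP/orP => [[d0 /existsP[k]]|].
  have := ltn_ord k => kr.
  by move=> /orP[/eqP|/eqP]; lia.
case=> [/andP[d0 dr]|dr]; split; try lia; apply/existsP.
  have kr : (d.-1 < r)%N by lia.
  by exists (Ordinal kr); rewrite /=; apply/orP; left; lia.
have kr : (n - d < r)%N by lia.
by exists (Ordinal kr); rewrite /=; apply/orP; right; lia.
Qed.

(** Since 2r < n, the r forward and the r backward neighbours of i are pairwise
    distinct, so a sum over the neighbourhood is a sum over the r offsets. With f
    constant this gives the degree, with f a Hartley column the eigenvalue. *)
Lemma sum_nn_cycle {V : nmodType} {r n : nat} (i : 'I_n) (f : nat -> V) :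
  (2 * r < n)%N ->
  \sum_(l < n | @nn_cycle r n i l) f l =
  \sum_(k < r) (f ((i + k.+1) %% n)%N + f ((i + (n - k.+1)) %% n)%N).
Proof.
case: n i => [[]//|n] i hn.
rewrite (reindex_inj (addrI i)) /=.
pose F d := f ((i + d) %% n.+1)%N.
under eq_bigl => d do rewrite nn_cycle_shift//.
rewrite -(big_mkord (fun d => (0 < d < r.+1)%N || (n.+1 - r <= d)%N) F).
(* Only the offsets in [1, r] and [n.+1 - r, n] contribute. *)
rewrite (@big_cat_nat _ _ _ 1)//= (@big_cat_nat _ _ _ r.+1 1) /=; [|lia..].
rewrite (@big_cat_nat _ _ _ (n.+1 - r) r.+1) /=; [|lia..].
rewrite big_nat_cond [X in X + _]big1 ?add0r; last by move=> d ?; exfalso; lia.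
rewrite [X in _ + (X + _)]big_nat_cond [X in _ + (X + _)]big1 ?add0r; last first.
  by move=> d ?; exfalso; lia.
rewrite big_split /=; congr (_ + _).
  rewrite big_add1 /= -(big_mkord predT (fun k => F k.+1)).
  by rewrite big_nat_cond [RHS]big_nat_cond; apply: eq_bigl => d /=; lia.
(* The top range is listed by decreasing offset n.+1 - k.+1. *)
rewrite big_nat_cond (eq_bigl (fun d => (n.+1 - r <= d < n.+1)%N && true)); last first.
  by move=> d; lia.
rewrite -big_nat_cond big_nat_rev -[X in \sum_(X <= _ < _) _]add0n big_addn.
rewrite (_ : (n.+1 - (n.+1 - r) = r)%N) ?big_mkord; last by lia.
by apply: eq_bigr => k _; rewrite /F; congr (f ((_ + _) %% _)%N); lia.
Qed.

(** * Sums of sinusoids over an arithmetic progression *)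

Section Trig.
Variable R : realType.
Implicit Types x y h c : R.

(** Each term telescopes, by
    2 sin h cos x = sin (x + h) - sin (x - h) with x advancing by 2h. The phase c
    is left free so that the formula covers sines as well as cosines. *)
Lemma sum_cos_progression h c (n : nat) :
  2 * sin h * \sum_(k < n) cos (c + h *+ 2 *+ k) =
  sin (c - h + h *+ 2 *+ n) - sin (c - h).
Proof.
elim: n => [|n IH]; first by rewrite big_ord0 mulr0 !mulr0n addr0 subrr.
rewrite big_ord_recr /= mulrDr IH.
set x := c + h *+ 2 *+ n.
have -> : c - h + h *+ 2 *+ n = x - h by rewrite /x addrAC.
have -> : c - h + h *+ 2 *+ n.+1 = x + h by rewrite /x mulrSr; ring.
by rewrite (sinB x) (sinD x); ring.
Qed.

Lemma sin_periodz x (z : int) : sin (x + pi *+ 2 *~ z) = sin x.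
Proof.
case: z => m; first exact: periodicn (@sinD2pi R) m x.
by rewrite NegzE mulrNz -[in RHS](subrK (pi *+ 2 *~ m.+1) x) (periodicn (@sinD2pi R)).
Qed.

Lemma cos_periodz x (z : int) : cos (x + pi *+ 2 *~ z) = cos x.
Proof.
case: z => m; first exact: periodicn (@cosD2pi R) m x.
by rewrite NegzE mulrNz -[in RHS](subrK (pi *+ 2 *~ m.+1) x) (periodicn (@cosD2pi R)).
Qed.

Lemma sum_cos_full_turns h c (n : nat) (z : int) : sin h != 0 ->
  h *+ 2 *+ n = pi *+ 2 *~ z -> \sum_(k < n) cos (c + h *+ 2 *+ k) = 0.
Proof.
move=> h0 hz; apply: (@mulfI _ (2 * sin h)); first by rewrite mulf_neq0 ?pnatr_eq0.
by rewrite sum_cos_progression hz sin_periodz subrr mulr0.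
Qed.

(** If sin h = 0 then h is a multiple of pi and every term vanishes; otherwise a
    sine is a cosine of phase - pi / 2. *)
Lemma sum_sin_full_turns h (n : nat) (z : int) :
  h *+ 2 *+ n = pi *+ 2 *~ z -> \sum_(k < n) sin (h *+ 2 *+ k) = 0.
Proof.
move=> hz; have [h0|h0] := eqVneq (sin h) 0.
  apply: big1 => k _; rewrite -mulrnA.
  elim: (2 * k)%N => [|m IH]; first by rewrite mulr0n sin0.
  by rewrite mulrSr sinD IH h0 mul0r mulr0 addr0.
rewrite -[RHS](sum_cos_full_turns h (- (pi / 2)) n z h0 hz).
by apply: eq_bigr => k _; rewrite cosD cosN sinN cos_pihalf sin_pihalf; ring.
Qed.

(** * The Hartley matrix *)

Definition cas x := cos x + sin x.

Lemma casM x y : cas x * cas y = cos (x - y) + sin (x + y).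
Proof. by rewrite /cas cosB sinD; ring. Qed.

Lemma casDB x y : cas (x + y) + cas (x - y) = 2 * cos y * cas x.
Proof. by rewrite /cas cosD sinD cosB sinB; ring. Qed.

Lemma cas_periodz x (z : int) : cas (x + pi *+ 2 *~ z) = cas x.
Proof. by rewrite /cas cos_periodz sin_periodz. Qed.

(** The half angle, rather than 2 pi j / n, is the basic quantity because it is
    the argument of the sine in the denominator of the Dirichlet kernel. *)
Definition half_angle (n j : nat) : R := pi * j%:R / n%:R.

Definition hartley_mx (n : nat) : 'M[R]_n :=
  \matrix_(i, j) cas (half_angle n j *+ 2 *+ i).

Lemma half_angle_turns n j : (0 < n)%N -> half_angle n j *+ 2 *+ n = pi *+ 2 *~ j.
Proof.
move=> n0; rewrite mulrnAC -[_ *+ n]mulr_natr /half_angle divfK ?pnatr_eq0 -?lt0n//.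
by rewrite mulr_natr mulrnAC pmulrn.
Qed.

Lemma sin_half_angle_gt0 n j : (0 < j < n)%N -> 0 < sin (half_angle n j).
Proof.
case/andP=> j0 jn; have n0 : (0 < n)%N by exact: leq_trans jn.
apply: sin_gt0_pi; rewrite /half_angle divr_gt0 ?mulr_gt0 ?pi_gt0 ?ltr0n//=.
by rewrite ltr_pdivrMr ?ltr0n// ltr_pM2l ?pi_gt0// ltr_nat.
Qed.

(** The difference of the two frequencies carries the orthogonality, as i - j is
    not a multiple of n unless i = j. The sum i + j may be one, but it only enters
    through sines, which then vanish termwise. *)
Lemma hartley_mxM n : hartley_mx n *m hartley_mx n = n%:R%:M.
Proof.
apply/matrixP => i j; rewrite !mxE.
have n0 : (0 < n)%N by exact: leq_trans (ltn_ord i).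
have sym (k : 'I_n) : half_angle n k *+ 2 *+ i = half_angle n i *+ 2 *+ k.
  rewrite !(mulrnAC _ 2) /half_angle; congr (_ *+ 2).
  by rewrite -[LHS]mulr_natr -[RHS]mulr_natr; ring.
under eq_bigr => k _ do rewrite !mxE sym casM -mulrnDl -mulrnBl -mulrnDl -mulrnBl.
rewrite big_split /= (@sum_sin_full_turns _ _ (i%:Z + j%:Z)) ?addr0; last first.
  by rewrite (mulrnDl 2) (mulrnDl n) !half_angle_turns// mulrzDr.
have [<-|neq] := eqVneq i j.
  under eq_bigr => k _ do rewrite subrr !mul0rn cos0.
  by rewrite sumr_const card_ord.
rewrite mulr0n.
under eq_bigr => k _ do rewrite -[_ *+ k]add0r.
apply: (@sum_cos_full_turns _ _ _ (i%:Z - j%:Z)); last first.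
  by rewrite (mulrnBl 2) (mulrnBl n) !half_angle_turns// mulrzBr.
have diff (a b : 'I_n) : (b < a)%N -> sin (half_angle n a - half_angle n b) != 0.
  move=> ba; rewrite gt_eqF// /half_angle -mulrBl -mulrBr -natrB 1?ltnW//.
  by apply: sin_half_angle_gt0; have := ltn_ord a; lia.
case: (ltngtP i j) => [ij|ji|/ord_inj ij]; last by rewrite ij eqxx in neq.
  by rewrite -opprB sinN oppr_eq0 diff.
exact: diff.
Qed.

Lemma det_hartley_mx n : \det (hartley_mx n) != 0.
Proof.
case: n => [|n]; first by rewrite det_mx00 oner_eq0.
apply/eqP => d0; have := congr1 determinant (hartley_mxM n.+1).
rewrite det_mulmx d0 mul0r det_scalar => /eqP.
by rewrite eq_sym expf_eq0 pnatr_eq0.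
Qed.

(** * Eigenvalues *)

(** The Hartley columns are eigenvectors of the adjacency matrix: forward and
    backward neighbours pair up through [casDB]. *)
Lemma sum_nn_cycle_cas {r n : nat} (i j : 'I_n) : (2 * r < n)%N ->
  \sum_(l < n | @nn_cycle r n i l) hartley_mx n l j =
  (\sum_(k < r) 2 * cos (half_angle n j *+ 2 *+ k.+1)) * hartley_mx n i j.
Proof.
move=> hn; pose t := half_angle n j *+ 2.
have n0 : (0 < n)%N by lia.
have tmod m : cas (t *+ (m %% n)) = cas (t *+ m).
  rewrite [in RHS](divn_eq m n) mulrnDr addrC mulnC mulrnA half_angle_turns//.
  by rewrite (pmulrn _ (m %/ n)) -mulrzA cas_periodz.
under eq_bigr => l _ do rewrite mxE -/t.
rewrite (sum_nn_cycle i (fun l => cas (t *+ l)) hn) mulr_suml mxE -/t.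
apply: eq_bigr => k _; rewrite !tmod.
have kn : (k.+1 <= n)%N by have := ltn_ord k; lia.
rewrite mulrnDr -casDB addnBA// mulrnBr; last by lia.
by congr (_ + _); rewrite mulrnDr half_angle_turns// addrAC cas_periodz.
Qed.

(** The Dirichlet kernel; the value prescribed at j = 0 is the one that makes the
    formula uniform in j. *)
Lemma sin_quotientE r n j : (j < n)%N ->
  sin_quotient R r n j = 1 + \sum_(k < r) 2 * cos (half_angle n j *+ 2 *+ k.+1).
Proof.
move=> jn; rewrite /sin_quotient; have [->|j0] := eqVneq j 0%N.
  rewrite (eq_bigr (fun=> 2)) => [|k _]; last first.
    by rewrite /half_angle mulr0 mul0r !mul0rn cos0 mulr1.
  by rewrite sumr_const card_ord natrD natrM mulr_natr addrC.
have s0 : sin (half_angle n j) != 0 by rewrite gt_eqF// sin_half_angle_gt0// lt0n j0.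
apply: (mulIf s0); rewrite divfK//.
have := sum_cos_progression (half_angle n j) (half_angle n j *+ 2) r.
set h := half_angle n j.
rewrite (_ : h *+ 2 - h = h); last by rewrite mulr2n addrK.
rewrite (_ : h + h *+ 2 *+ r = (2 * r + 1)%:R * pi * j%:R / n%:R); last first.
  by rewrite -mulrnA -mulrS addn1 -[LHS]mulr_natl /h /half_angle !mulrA.
move=> E; rewrite mulrDl mul1r -mulr_sumr [in RHS]mulrAC.
under eq_bigr => k _ do rewrite mulrS.
by rewrite E addrC subrK.
Qed.

End Trig.

Theorem theorem2 (R : realType) (r n : nat) (hr : (1 <= r)%N)
    (hn : (2 * r < n)%N) :
  eigenvalues_listed_by (laplacian_mx R (@nn_cycle r n))
    [seq (2 * r + 1)%:R - sin_quotient R r n j | j <- iota 0 n].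
Proof.
pose ev j := (2 * r + 1)%:R - sin_quotient R r n j.
pose D : 'M[R]_n := diag_mx (\row_j ev j).
have eig : laplacian_mx R (@nn_cycle r n) *m hartley_mx R n = hartley_mx R n *m D.
  rewrite mulmxBl; apply/matrixP => i j.
  rewrite mul_diag_mx mul_mx_diag !mxE.
  have -> : degree (@nn_cycle r n) i = (2 * r)%N.
    rewrite /degree -sum1_card (eq_bigl (@nn_cycle r n i)); last by move=> l; rewrite inE.
    by rewrite (sum_nn_cycle i (fun=> 1%N) hn) sum_nat_const card_ord mulnC.
  rewrite (eq_bigr (fun l => if @nn_cycle r n i l then hartley_mx R n l j else 0)); last first.
    by move=> l _; rewrite mxE; case: ifP => _; rewrite (mul1r, mul0r).
  rewrite -big_mkcond /= sum_nn_cycle_cas// mxE /ev sin_quotientE// natrD; ring.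
rewrite /eigenvalues_listed_by (char_poly_similar (det_hartley_mx R n) eig).
rewrite char_poly_trig ?diag_mx_is_trig// big_map.
rewrite (_ : iota 0 n = index_iota 0 n) ?big_mkord; last first.
  by rewrite /index_iota subn0.
by apply: eq_bigr => i _; rewrite !mxE eqxx.
Qed.
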